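(* Let $R$ be a ring and $M$ an $R$-module. If $(E,I)$ and $(F,J)$ are linear filtrations of $M$, then for each $(i,j)\in I\times J$, $$[E\cap F]_{<(i,j)}=E_i\cap F_{<j}+E_{<i}\cap F_j,$$ and therefore their intersection $(E\cap F,\,I\times J)$ is distributive.
   Context: A poset filtration $(F,P)$ of an $R$-module $M$ is a partially ordered set $(P,\le)$ with an order-preserving function $F:P\to\mathrm{Sub}(M)$, $p\mapsto F_p$, to the poset of submodules of $M$; it is linear if $P$ is totally ordered. Write $F_{<p}=\sum_{q<p}F_q$ (zero if there is no $q<p$). $I\times J$ has the product order $(k,\ell)\le(i,j)$ iff $k\le i$ and $\ell\le j$. The intersection $(E\cap F,I\times J)$ is the poset filtration $[E\cap F]_{(i,j)}=E_i\cap F_j$, so $[E\cap F]_{<(i,j)}=\sum_{(k,\ell)<(i,j)}E_k\cap F_\ell$. A poset filtration $(F,P)$ is distributive if for all finite subsets $Q\subseteq P$ and all $p\in Q$ that are maximal in $Q$, $F_p\cap\sum_{q\in Q\smallsetminus\{p\}}F_q\subseteq F_{<p}$. *)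

(* Defs.v *)
From HB Require Import structures.
From mathcomp Require Import all_boot all_order all_algebra.
From mathcomp Require Import boolp finmap.

Set Implicit Arguments.
Unset Strict Implicit.
Unset Printing Implicit Defensive.

Import Order.TTheory GRing.Theory.

Local Open Scope ring_scope.

(* Sub(M) is the library type [submodClosed M], whose elements are boolean
   predicates on M.  Classically (boolp) every Prop-valued predicate is of this
   form; two submodules are equal when they are extensionally equal ([=i]), and
   inclusion is [{subset _ <= _}]. *)

Section Submodules.
Variables (R : pzRingType) (M : lmodType R).

Definition cap_pred (U V : submodClosed M) : {pred M} := [predI U & V].

Fact cap_closed (U V : submodClosed M) : subsemimod_closed (cap_pred U V).
Proof.
split; first split.
- by rewrite inE /= !rpred0.
- by move=> x y /andP[xU xV] /andP[yU yV]; rewrite inE /= !rpredD.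
- by move=> a x /andP[xU xV]; rewrite inE /= !rpredZ.
Qed.

HB.instance Definition _ (U V : submodClosed M) :=
  GRing.isSubmodClosed.Build R M (cap_pred U V) (cap_closed U V).

Definition submod_cap (U V : submodClosed M) : submodClosed M := cap_pred U V.

Definition add_pred (U V : submodClosed M) : {pred M} :=
  fun x => `[< exists u v, [/\ u \in U, v \in V & x = u + v] >].

Fact add_closed (U V : submodClosed M) : subsemimod_closed (add_pred U V).
Proof.
split; first split.
- by apply/asboolP; exists 0, 0; rewrite !rpred0 addr0.
- move=> _ _ /asboolP[u [v [uU vV ->]]] /asboolP[u' [v' [uU' vV' ->]]].
  by apply/asboolP; exists (u + u'), (v + v'); rewrite !rpredD // addrACA.
- move=> a _ /asboolP[u [v [uU vV ->]]].
  by apply/asboolP; exists (a *: u), (a *: v); rewrite !rpredZ // scalerDr.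
Qed.

HB.instance Definition _ (U V : submodClosed M) :=
  GRing.isSubmodClosed.Build R M (add_pred U V) (add_closed U V).

Definition submod_add (U V : submodClosed M) : submodClosed M := add_pred U V.

(* The sum of the submodules F q over all q in a possibly infinite D consists
   of the finite sums of elements of the F q; it is zero when D is empty. *)
Definition sum_pred (T : choiceType) (D : {pred T}) (F : T -> submodClosed M) :
    {pred M} :=
  fun x => `[< exists (S : {fset T}) (f : T -> M),
    [/\ {subset S <= D}, forall q, q \in S -> f q \in F q
      & x = \sum_(q <- S) f q] >].

Fact sum_closed (T : choiceType) (D : {pred T}) (F : T -> submodClosed M) :
  subsemimod_closed (sum_pred D F).
Proof.
split; first split.
- by apply/asboolP; exists fset0, (fun=> 0); rewrite big_seq_fset0; split.
- move=> _ _ /asboolP[S [f [SD fF ->]]] /asboolP[S' [f' [SD' fF' ->]]].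
  pose g (A : {fset T}) (h : T -> M) q := if q \in A then h q else 0.
  have gE (A B : {fset T}) h : (A `<=` B)%fset ->
      \sum_(q <- A) h q = \sum_(q <- B) g A h q.
    move=> AB; transitivity (\sum_(q <- A) g A h q).
      by apply: eq_big_seq => q qA; rewrite /g qA.
    by apply: big_fset_incl AB _ => q _ /negbTE qA; rewrite /g qA.
  apply/asboolP; exists (S `|` S')%fset, (fun q => g S f q + g S' f' q); split.
  + by move=> q; rewrite inE => /orP[/SD|/SD'].
  + move=> q _; rewrite rpredD // /g; case: ifP => [qS|_]; rewrite ?rpred0 //.
      exact: fF.
    exact: fF'.
  + by rewrite big_split /= -!gE ?fsubsetUl ?fsubsetUr.
- move=> a _ /asboolP[S [f [SD fF ->]]].
  apply/asboolP; exists S, (fun q => a *: f q); split=> //.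
    by move=> q qS; rewrite rpredZ ?fF.
  by rewrite scaler_sumr.
Qed.

HB.instance Definition _ (T : choiceType) (D : {pred T})
    (F : T -> submodClosed M) :=
  GRing.isSubmodClosed.Build R M (sum_pred D F) (sum_closed D F).

Definition submod_sum (T : choiceType) (D : {pred T})
    (F : T -> submodClosed M) : submodClosed M := sum_pred D F.

End Submodules.

(* A filtration indexed by an [orderType] is a linear filtration. *)
Record filtration (R : pzRingType) (M : lmodType R)
    (d : Order.disp_t) (P : porderType d) := Filtration {
  filt_fun :> P -> submodClosed M;
  filt_homo : forall p q : P, (p <= q)%O -> {subset filt_fun p <= filt_fun q}
}.
Arguments filtration {R} M {d} P.

Definition filt_lt (R : pzRingType) (M : lmodType R) (d : Order.disp_t)
    (P : porderType d) (F : filtration M P) (p : P) : submodClosed M :=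
  submod_sum [pred q : P | (q < p)%O] F.

Section Intersection.
Variables (R : pzRingType) (M : lmodType R) (dI dJ : Order.disp_t).
Variables (I : porderType dI) (J : porderType dJ).
Variables (E : filtration M I) (F : filtration M J).

Let cap_fun (p : I *p J) : submodClosed M := submod_cap (E p.1) (F p.2).

Fact filt_cap_homo (p q : I *p J) :
  (p <= q)%O -> {subset cap_fun p <= cap_fun q}.
Proof.
rewrite leEprod => /andP[le1 le2] x /andP[xE xF].
by apply/andP; split; [apply: filt_homo xE | apply: filt_homo xF].
Qed.

(* [I *p J] is the product I * J with the componentwise order. *)
Definition filt_cap : filtration M (I *p J) := Filtration filt_cap_homo.

End Intersection.

Definition distributive_filt (R : pzRingType) (M : lmodType R)
    (d : Order.disp_t) (P : porderType d) (F : filtration M P) : Prop :=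
  forall (Q : {fset P}) (p : P), p \in Q ->
    (forall q, q \in Q -> ~~ (p < q)%O) ->
    {subset submod_cap (F p) (submod_sum (mem (Q `\ p)%fset) F) <= filt_lt F p}.

(* Main.v *)
Require Import Defs.
From mathcomp Require Import all_boot all_order all_algebra.
From mathcomp Require Import boolp finmap.

(** Linearity enters in two ways.

    Because the index set is a chain, the sum [F_{<j}] is a directed union: an
    element of it is zero or already lies in a single [F_l] with [l < j]
    ([filt_lt_linear]).  Hence every nonzero element of [E_i \cap F_{<j}] lies in
    some [E_i \cap F_l] with [l < j], which is a term of
    [[E \cap F]_{<(i,j)}]; symmetrically for [E_{<i} \cap F_j].  Conversely
    [(k, l) < (i, j)] forces [k < i] or [l < j], so each term of
    [[E \cap F]_{<(i,j)}] is in one of the two summands.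

    For distributivity, maximality of [(i, j)] in [Q] and totality of the two
    orders give [k < i] or [l < j] for every other [(k, l)] of [Q].  An element
    [x] of [\sum E_k \cap F_l] over those pairs is therefore [a + b] with
    [a] in [E_{<i}] and [b] in [F_{<j}].  If moreover [x] lies in
    [E_i \cap F_j], then [b = x - a] lies in [E_i] and [a = x - b] in [F_j]
    ([cap_add_modular]), so the formula puts [x] in [[E \cap F]_{<(i,j)}]. *)

Set Implicit Arguments.
Unset Strict Implicit.
Unset Printing Implicit Defensive.

Import Order.TTheory GRing.Theory.

Local Open Scope ring_scope.

Section Submodules.
Variables (R : pzRingType) (M : lmodType R).
Implicit Types (U V A B : submodClosed M).

Lemma submod_rpredB U x y : x \in U -> y \in U -> x - y \in U.
Proof. by move=> xU yU; rewrite -scaleN1r rpredD ?rpredZ. Qed.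

Lemma mem_submod_cap U V x : (x \in submod_cap U V) = (x \in U) && (x \in V).
Proof. by []. Qed.

Lemma submod_addP U V x :
  reflect (exists u v, [/\ u \in U, v \in V & x = u + v]) (x \in submod_add U V).
Proof. exact: asboolP. Qed.

Lemma submod_sumP (T : choiceType) (D : {pred T}) (F : T -> submodClosed M) x :
  reflect (exists (S : {fset T}) (f : T -> M),
            [/\ {subset S <= D}, forall q, q \in S -> f q \in F q
              & x = \sum_(q <- S) f q])
          (x \in submod_sum D F).
Proof. exact: asboolP. Qed.

Lemma subset_submod_sum (T : choiceType) (D : {pred T})
    (F : T -> submodClosed M) q :
  q \in D -> {subset F q <= submod_sum D F}.
Proof.
move=> qD x xF; apply/submod_sumP; exists [fset q]%fset, (fun=> x); split.
- by move=> r; rewrite inE => /eqP->.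
- by move=> r; rewrite inE => /eqP->.
- by rewrite big_seq_fset1.
Qed.

Lemma submod_sum_subset (T : choiceType) (D : {pred T})
    (F : T -> submodClosed M) V :
  (forall q, q \in D -> {subset F q <= V}) -> {subset submod_sum D F <= V}.
Proof.
move=> FV x /submod_sumP[S [f [SD fF ->]]].
by rewrite big_seq rpred_sum // => q qS; apply: FV (SD q qS) _ (fF q qS).
Qed.

Lemma subset_submod_addl U V : {subset U <= submod_add U V}.
Proof. by move=> x xU; apply/submod_addP; exists x, 0; rewrite addr0 rpred0. Qed.

Lemma subset_submod_addr U V : {subset V <= submod_add U V}.
Proof. by move=> x xV; apply/submod_addP; exists 0, x; rewrite add0r rpred0. Qed.

(** The modular law applied twice: when [x = a + b] lies in [U], so does the
    summand [b = x - a], since [a] already does; likewise for [a] and [V]. *)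
Lemma cap_add_modular U V A B :
    {subset A <= U} -> {subset B <= V} ->
  {subset submod_cap (submod_cap U V) (submod_add A B)
     <= submod_add (submod_cap U B) (submod_cap A V)}.
Proof.
move=> AU BV x /andP[/andP[xU xV] /submod_addP[a [b [aA bB x_eq]]]].
move: xU xV; rewrite x_eq => xU xV.
apply/submod_addP; exists b, a; rewrite !mem_submod_cap aA bB addrC andbT /=.
split=> //.
- by rewrite -[b](addKr a) addrC submod_rpredB // AU.
- by rewrite -[a](addrK b) submod_rpredB // BV.
Qed.

End Submodules.

Section Filtrations.
Variables (R : pzRingType) (M : lmodType R).

Lemma filt_lt_subset (d : Order.disp_t) (P : porderType d)
    (F : filtration M P) p :
  {subset filt_lt F p <= F p}.
Proof. by apply: submod_sum_subset => q /ltW; apply: filt_homo. Qed.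

Lemma subset_filt_lt (d : Order.disp_t) (P : porderType d)
    (F : filtration M P) p q :
  (q < p)%O -> {subset F q <= filt_lt F p}.
Proof.
by move=> qp; apply: (@subset_submod_sum _ _ _ [pred r | (r < p)%O]).
Qed.

(** Over a chain, two terms of a sum lie in the later of their two submodules,
    so that a finite sum collapses into one [F q].  The case [x = 0] is the
    empty sum: when [p] is minimal there is no [F q] for it to belong to. *)
Lemma filt_lt_linear (d : Order.disp_t) (P : orderType d)
    (F : filtration M P) p x :
  x \in filt_lt F p -> x = 0 \/ exists2 q, (q < p)%O & x \in F q.
Proof.
move=> /submod_sumP[S [f [Sp fF ->]]]; rewrite big_seq.
apply: (big_ind (fun x => x = 0 \/ exists2 q, (q < p)%O & x \in F q)).
- by left.
- move=> y z [->|[q qp yF]]; first by rewrite add0r.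
  case=> [->|[r rp zF]]; first by rewrite addr0; right; exists q.
  right; exists (Order.max q r); first by rewrite gt_max qp.
  apply: rpredD; first by apply: filt_homo yF; rewrite le_max lexx.
  by apply: filt_homo zF; rewrite le_max lexx orbT.
- by move=> q qS; right; exists q; [apply: Sp | apply: fF].
Qed.

Section Intersection.
Variables (dI dJ : Order.disp_t) (I : orderType dI) (J : orderType dJ).
Variables (E : filtration M I) (F : filtration M J).

Lemma filt_lt_cap i j :
  filt_lt (filt_cap E F) (i, j)
    =i submod_add (submod_cap (E i) (filt_lt F j))
                  (submod_cap (filt_lt E i) (F j)).
Proof.
move=> x; apply/idP/idP.
- apply: submod_sum_subset => -[k l] kl_lt y /andP[/= yE yF].
  move: kl_lt; rewrite inE ltEprod xpair_eqE negb_and /=.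
  case/andP=> kl_neq /andP[ki lj].
  have yEi := filt_homo ki yE; have yFj := filt_homo lj yF.
  case/orP: kl_neq => [k_neq|l_neq].
    apply: subset_submod_addr; rewrite mem_submod_cap yFj andbT.
    by apply: subset_filt_lt yE; rewrite lt_neqAle k_neq.
  apply: subset_submod_addl; rewrite mem_submod_cap yEi /=.
  by apply: subset_filt_lt yF; rewrite lt_neqAle l_neq.
- move=> /submod_addP[u [v [/andP[uE uF] /andP[vE vF] ->]]].
  apply: rpredD.
  + have [->|[l lj uFl]] := filt_lt_linear uF; first exact: rpred0.
    apply: (@subset_filt_lt _ _ (filt_cap E F) _ (i, l)).
      by rewrite ltEprod /= lexx ltW // xpair_eqE eqxx lt_eqF.
    by rewrite [_ \in _]mem_submod_cap uE.
  + have [->|[k ki vEk]] := filt_lt_linear vE; first exact: rpred0.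
    apply: (@subset_filt_lt _ _ (filt_cap E F) _ (k, j)).
      by rewrite ltEprod /= lexx ltW // xpair_eqE lt_eqF.
    by rewrite [_ \in _]mem_submod_cap vEk.
Qed.

Lemma filt_cap_distributive : distributive_filt (filt_cap E F).
Proof.
move=> Q [i j] _ ij_max x /andP[x_cap x_sum].
rewrite filt_lt_cap; apply: cap_add_modular; try exact: filt_lt_subset.
rewrite mem_submod_cap; apply/andP; split; first exact: x_cap.
move: x x_sum {x_cap}; apply: submod_sum_subset => -[k l] kl_Q y /andP[/= yE yF].
move: kl_Q; rewrite !inE => /andP[kl_neq /ij_max].
have [k_lt _|ik] := ltP k i.
  by apply: subset_submod_addl; apply: subset_filt_lt yE.
have [l_lt _|jl] := ltP l j.
  by apply: subset_submod_addr; apply: subset_filt_lt yF.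
(* If neither coordinate drops, (k, l) lies strictly above (i, j). *)
by rewrite ltEprod /= ik jl eq_sym kl_neq.
Qed.

End Intersection.
End Filtrations.

Theorem proposition6p2 (R : pzRingType) (M : lmodType R)
    (dI dJ : Order.disp_t) (I : orderType dI) (J : orderType dJ)
    (E : filtration M I) (F : filtration M J) :
  (forall (i : I) (j : J),
     filt_lt (filt_cap E F) (i, j)
       =i submod_add (submod_cap (E i) (filt_lt F j))
                     (submod_cap (filt_lt E i) (F j)))
  /\ distributive_filt (filt_cap E F).
Proof.
by split; [apply: filt_lt_cap | apply: filt_cap_distributive].
Qed.
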